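(* Let $(X,\mathcal{B}_X,\mu,T)$ be a $\mathbb{Z}^2$-MPS and let $\alpha$ be a finite measurable partition of $X$. If there exists an infinite subset $S$ of $\mathbb{Z}^2$ such that $h^S_{\mu}(T,\alpha)>0$, then there is at most one direction $\vec{v}=(1,\beta)\in\mathbb{R}^2$ such that $h_\mu^{\vec{v},*}(\alpha)=0$.
   Context: A $\mathbb{Z}^2$-measure preserving dynamical system ($\mathbb{Z}^2$-MPS) is a quadruple $(X,\mathcal{B}_X,\mu,T)$ where $X$ is a compact metric space, $\mathcal{B}_X$ its Borel $\sigma$-algebra, $T$ assigns to each $\vec{w}\in\mathbb{Z}^2$ a homeomorphism $T^{\vec{w}}:X\to X$ with $T^{\vec{w}}\circ T^{\vec{u}}=T^{\vec{w}+\vec{u}}$ and $T^{\vec{0}}=\mathrm{id}_X$, and $\mu$ is a Borel probability measure on $X$ invariant under every $T^{\vec{w}}$. For $\vec{v}=(1,\beta)\in\mathbb{R}^2$ and $b>0$ put $\Lambda^{\vec{v}}(b)=\{(m,n)\in\mathbb{Z}^2:\beta m-b/2\leq n\leq \beta m+b/2\}$. For a finite measurable partition $\alpha$, $H_\mu(\alpha)=-\sum_{A\in\alpha}\mu(A)\log\mu(A)$ (with $0\log 0=0$). An infinite subset $S=\{(m_i,n_i)\}_{i=1}^\infty$ of $\mathbb{Z}^2$ is understood to come with an enumeration as a sequence of pairwise distinct elements; put $$h^S_{\mu}(T,\alpha)=\limsup_{k\to\infty}\frac1k H_\mu\left(\bigvee_{i=1}^k T^{-(m_i,n_i)}\alpha\right).$$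 Define $$h_\mu^{\vec{v},*}(\alpha)=\sup_{S\subset\Lambda^{\vec{v}}(b)} h^S_\mu(T,\alpha),$$ the supremum being over all infinite subsets $S=\{(m_i,n_i)\}_{i=1}^\infty$ of $\Lambda^{\vec{v}}(b)$; this quantity does not depend on the choice of $b\in(0,\infty)$. *)

(* Defs.v *)
From HB Require Import structures.
From mathcomp Require Import all_boot all_order all_algebra.
From mathcomp Require Import all_classical all_reals all_analysis.

Set Implicit Arguments.
Unset Strict Implicit.
Unset Printing Implicit Defensive.

Import Order.TTheory GRing.Theory Num.Theory.
Import numFieldNormedType.Exports.

Local Open Scope classical_set_scope.
Local Open Scope ring_scope.

(* The library's measurable types are pointed.  A space that carries a
   probability measure is nonempty, so the point is not a restriction. *)
#[short(type="pmetricType")]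
HB.structure Definition PointedMetric (R : numDomainType) :=
  {X of Pointed X & Metric R X}.

Definition borel {R : realType} (X : pmetricType R) :=
  g_sigma_algebraType (@open X).

Definition homeomorphism {X Y : topologicalType} (f : X -> Y) : Prop :=
  continuous f /\ exists g : Y -> X, [/\ cancel f g, cancel g f & continuous g].

Record is_Z2MPS {R : realType} (X : pmetricType R)
    (mu : probability (borel X) R) (T : int * int -> X -> X) : Prop := {
  Z2MPS_compact : compact [set: X] ;
  Z2MPS_homeo : forall w, homeomorphism (T w) ;
  Z2MPS_add : forall w u, T w \o T u = T (w + u) ;
  Z2MPS_id : T 0 = id ;
  Z2MPS_invariant : forall w (A : set (borel X)),
    measurable A -> mu (T w @^-1` A) = mu A
}.

(* A partition is the set of its (nonempty) cells. *)
Definition finite_measurable_partition {R : realType} (X : pmetricType R)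
    (alpha : set (set (borel X))) : Prop :=
  [/\ finite_set alpha, partition alpha id [set: borel X] &
      forall A, alpha A -> measurable A].

(* The convention 0 log 0 = 0 holds because [ln] is total. *)
Definition entropy {R : realType} (X : pmetricType R)
    (mu : probability (borel X) R) (alpha : set (set (borel X))) : R :=
  - \sum_(A \in alpha) fine (mu A) * ln (fine (mu A)).

(* The join of the partitions [P 0], ..., [P (k - 1)]. *)
Definition join_partition {X : Type} (P : nat -> set (set X)) (k : nat) :
    set (set X) :=
  [set B | B !=set0 /\ exists2 C : nat -> set X,
     (forall i, (i < k)%N -> P i (C i)) & B = \bigcap_(i in `I_k) C i].

(* T^{-w} alpha, whose cells are the images of the cells of alpha under the
   homeomorphism T^{-w}. *)
Definition pullback_partition {X : Type} (T : int * int -> X -> X)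
    (w : int * int) (alpha : set (set X)) : set (set X) :=
  [set T (- w) @` A | A in alpha].

(* An infinite subset S of Z^2 comes with an enumeration, so it is given as an
   injective sequence [s], and [s i] is the element of index i + 1.
   The limsup is over k >= 1, whence the shift. *)
Definition seq_entropy {R : realType} (X : pmetricType R)
    (mu : probability (borel X) R) (T : int * int -> X -> X)
    (alpha : set (set (borel X))) (s : nat -> int * int) : \bar R :=
  limn_esup (fun k : nat =>
    (k.+1%:R^-1 * entropy mu
       (join_partition (fun i => pullback_partition T (s i) alpha) k.+1))%:E).

Definition strip {R : realType} (beta b : R) : set (int * int) :=
  [set w | beta * w.1%:~R - b / 2 <= w.2%:~R <= beta * w.1%:~R + b / 2].

(* h_mu^{v,*}(alpha) for v = (1, beta), computed in the strip of width [b]. *)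
Definition dir_seq_entropy {R : realType} (X : pmetricType R)
    (mu : probability (borel X) R) (T : int * int -> X -> X)
    (alpha : set (set (borel X))) (b beta : R) : \bar R :=
  ereal_sup [set seq_entropy mu T alpha s | s in
    [set s : nat -> int * int | injective s /\ range s `<=` strip beta b]].

(* Main.v *)
Require Import Defs.
From HB Require Import structures.
From mathcomp Require Import all_boot all_order all_algebra.
From mathcomp Require Import all_classical all_reals all_analysis.
From mathcomp Require Import lra.

Set Implicit Arguments.
Unset Strict Implicit.
Unset Printing Implicit Defensive.

Import Order.TTheory GRing.Theory Num.Theory.
Import numFieldNormedType.Exports.

Local Open Scope classical_set_scope.
Local Open Scope ring_scope.

(** The proof separates a combinatorial statement about set functions on Z^2
    from the entropy of partitions.

    For a finite family F of elements of Z^2 let h(F) be the entropy of the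
    join of the T^{-w} alpha, w in F.  The function h is monotone, submodular
    and invariant under translation of F; these properties are all that is
    used of entropy ([join_ent_entropy_like]).  Write h(A | C) for
    h(A u C) - h(C), and call a set L of times precompact when, for every
    e > 0, some finite F satisfies h({w} | F) <= e for all w in L: finitely
    many translates of alpha nearly determine all those indexed by L.

    Suppose that L is not precompact.  Then, for some e > 0, every finite past
    can be prolonged by an element of L that carries at least e of new
    information, and prolonging the past again and again gives an infinite
    sequence in L whose sequence entropy is at least e
    ([not_precompact_linear]).  So the vanishing of the directional sequence
    entropy makes the strip precompact.  Conversely, if the whole of Z^2 is
    precompact, then h(s_0, ..., s_(k-1)) <= h(F) + k e along every sequence,
    and every sequence entropy vanishes ([precompact_sublinear]).

    It remains to go from two strips to the plane.  Precompactness passes to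
    sums: w1 + w2 is nearly determined by w1 + F2 because h is translation
    invariant, and each of the finitely many w1 + f2 is nearly determined by
    F1 + f2, so w1 + w2 is nearly determined by F1 + F2
    ([precompact_add]).  Finite sets are precompact, and a wide strip is
    covered by finitely many translates of a narrow one, hence the strips of
    all widths in the two directions are precompact.  When the directions
    differ, two sufficiently wide strips add up to Z^2
    ([plane_two_strips]). *)

(** * Monotone, submodular, translation-invariant set functions *)

(** Finite sets of times are given as sequences; monotonicity already makes
    [h] insensitive to order and repetition.  Submodularity is stated for
    unions with a common part, the form in which conditional entropy
    decreases when one conditions on more. *)
Record entropy_like {G : zmodType} {R : realFieldType} (h : seq G -> R) : Prop
  := {
  ent_nil : h [::] = 0 ;
  ent_mono : forall A B, {subset A <= B} -> h A <= h B ;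
  ent_submod : forall A B C,
    h (A ++ B ++ C) + h C <= h (A ++ C) + h (B ++ C) ;
  ent_shift : forall w A, h [seq w + a | a <- A] = h A
}.

Definition cond_ent {G : zmodType} {R : realFieldType} (h : seq G -> R)
  (A C : seq G) : R := h (A ++ C) - h C.

(** For the entropy of joins this amounts to total boundedness of the family
    of the T^{-w} alpha, w in L, in the Rokhlin metric. *)
Definition ent_precompact {G : zmodType} {R : realFieldType} (h : seq G -> R)
    (L : set G) : Prop :=
  forall e, 0 < e -> exists F : seq G,
    forall w, L w -> cond_ent h [:: w] F <= e.

Section EntropyLike.
Variables (G : zmodType) (R : realFieldType) (h : seq G -> R).
Hypothesis hE : entropy_like h.
Local Notation hc := (cond_ent h).

Lemma ent_eq A B : A =i B -> h A = h B.
Proof.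
by move=> AB; apply/eqP; rewrite eq_le !(ent_mono hE)// => x; rewrite AB.
Qed.

Lemma cond_ent_cat A B C : hc (A ++ B) C = hc A (B ++ C) + hc B C.
Proof. by rewrite /cond_ent -catA addrA subrK. Qed.

Lemma cond_ent_le A A' C C' :
  {subset A <= A'} -> {subset C' <= C} -> hc A C <= hc A' C'.
Proof.
move=> sA sC.
have := ent_submod hE A C C'.
have -> : h (C ++ C') = h C.
  apply: ent_eq => x; rewrite mem_cat.
  by case: (boolP (x \in C')) => [/sC ->|]; rewrite ?orbF.
have -> : h (A ++ C ++ C') = h (A ++ C).
  apply: ent_eq => x; rewrite !mem_cat.
  by case: (boolP (x \in C')) => [/sC ->|]; rewrite ?orbF.
have : h (A ++ C') <= h (A' ++ C').
  apply: (ent_mono hE) => x; rewrite !mem_cat => /orP[/sA ->//|->].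
  by rewrite orbT.
rewrite /cond_ent; lra.
Qed.

Lemma cond_ent_triangle A B C : hc A C <= hc A B + hc B C.
Proof.
apply: (@le_trans _ _ (hc (A ++ B) C)).
  by apply: cond_ent_le => // x; rewrite mem_cat => ->.
rewrite cond_ent_cat lerD2r; apply: cond_ent_le => // x.
by rewrite mem_cat => ->.
Qed.

Lemma cond_ent_sub A C : {subset A <= C} -> hc A C = 0.
Proof.
move=> sA; rewrite /cond_ent (@ent_eq (A ++ C) C) ?subrr// => x.
by rewrite mem_cat; case: (boolP (x \in A)) => // /sA ->.
Qed.

Lemma cond_ent_le_sum A C : hc A C <= \sum_(a <- A) hc [:: a] C.
Proof.
elim: A => [|a A IH]; first by rewrite big_nil cond_ent_sub.
rewrite big_cons (cond_ent_cat [:: a]) lerD//; apply: cond_ent_le => // x.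
by rewrite mem_cat orbC => ->.
Qed.

Lemma cond_ent_shift w A C :
  hc [seq w + a | a <- A] [seq w + c | c <- C] = hc A C.
Proof. by rewrite /cond_ent -map_cat !(ent_shift hE). Qed.

Lemma precompact_subset (L L' : set G) :
  L `<=` L' -> ent_precompact h L' -> ent_precompact h L.
Proof. by move=> LL' cL e /cL[F FP]; exists F => w /LL'; exact: FP. Qed.

Lemma precompact_seq (A : seq G) : ent_precompact h [set` A].
Proof.
move=> e e0; exists A => w wA; rewrite cond_ent_sub ?ltW// => x.
by rewrite inE => /eqP ->.
Qed.

(** The finite set [F2] is chosen before [F1]: passing from [w1 + F2] to
    [F1 + F2] costs one error term for each element of [F2], so the error
    allowed to [F1] has to depend on the size of [F2]. *)
Lemma precompact_add (L1 L2 : set G) :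
  ent_precompact h L1 -> ent_precompact h L2 ->
  ent_precompact h [set w1 + w2 | w1 in L1 & w2 in L2].
Proof.
move=> c1 c2 e e0.
have [F2 F2P] := c2 _ (divr_gt0 e0 (ltr0n _ 2)).
have N0 : 0 < (size F2).+1%:R :> R by rewrite ltr0n.
have [F1 F1P] := c1 _ (divr_gt0 (divr_gt0 e0 (ltr0n _ 2)) N0).
exists [seq f1 + f2 | f1 <- F1, f2 <- F2] => _ [w1 Lw1] [w2 Lw2] <-.
apply: (le_trans (cond_ent_triangle _ [seq w1 + f2 | f2 <- F2] _)).
(* By translation invariance the first error is that of [w2] given [F2]. *)
rewrite [leRHS](splitr e); apply: lerD.
  by rewrite (cond_ent_shift _ [:: w2]); exact: F2P.
apply: (le_trans (cond_ent_le_sum _ _)); rewrite big_map.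
apply: (@le_trans _ _ (\sum_(f2 <- F2) (e / 2 / (size F2).+1%:R))).
  rewrite !big_seq; apply: ler_sum => f2 f2F.
  rewrite (le_trans _ (F1P _ Lw1))//.
  rewrite -(cond_ent_shift f2 [:: w1]) /=; apply: cond_ent_le => x.
    by rewrite addrC.
  move=> /mapP[f1 f1F ->]; rewrite addrC.
  by apply/allpairsP; exists (f1, f2).
rewrite big_const_seq count_predT iter_addr_0 -[leLHS]mulr_natr.
rewrite -[leLHS]mulrA ger_pMr ?divr_gt0//.
by rewrite ler_pdivrMl// mulr1 ler_nat.
Qed.

(** After paying once for the finite set that nearly determines everything,
    each further term of the sequence costs at most [e]. *)
Lemma precompact_sublinear (s : nat -> G) (e : R) :
  ent_precompact h setT -> 0 < e -> exists C, 0 <= C /\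
    forall k, h (mkseq s k) <= C + k%:R * e.
Proof.
move=> c e0; have [F FP] := c _ e0; exists (h F); split.
  by rewrite -(ent_nil hE); exact: (ent_mono hE).
move=> k; apply: (@le_trans _ _ (h (mkseq s k ++ F))).
  by apply: (ent_mono hE) => x; rewrite mem_cat => ->.
rewrite -lerBlDl; apply: (le_trans (cond_ent_le_sum _ _)).
apply: (@le_trans _ _ (\sum_(a <- mkseq s k) e)).
  by apply: ler_sum => a _; exact: FP.
by rewrite big_const_seq count_predT iter_addr_0 size_mkseq mulr_natl.
Qed.

(** Greedy choice of a sequence: each term carries more than [e] of
    information that the earlier terms do not have.  A repeated term would
    carry none, so the terms are distinct. *)
Lemma not_precompact_linear (L : set G) : ~ ent_precompact h L ->
  exists e, 0 < e /\ exists s : nat -> G, [/\ injective s, range s `<=` L &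
    forall k, k%:R * e <= h (mkseq s k)].
Proof.
move=> /existsNP[e /not_implyP[e0 /forallNP noF]]; exists e; split=> //.
have /choice[pick pickP] (F : seq G) : exists w, L w /\ e < hc [:: w] F.
  have /existsNP[w /not_implyP[Lw /negP]] := noF F.
  by rewrite -ltNge => ?; exists w.
pose past n := iter n (fun F => rcons F (pick F)) [::].
pose s n := pick (past n).
have sE n : mkseq s n = past n.
  by elim: n => // n IH; rewrite mkseqS IH.
have sN i j : (i < j)%N -> s i != s j.
  move=> ij; apply/eqP => sij; have [_] := pickP (past j).
  rewrite -/(s j) -sij cond_ent_sub ?ltNge ?ltW// => x.
  rewrite inE -sE => /eqP ->; apply/mapP; exists i => //.
  by rewrite mem_iota.
exists s; split.
- move=> i j /eqP sij; apply/eqP; case: ltngtP => // [/sN|/sN] /negP[//].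
  by rewrite eq_sym.
- by move=> _ [n _ <-]; have [] := pickP (past n).
- elim=> [|k IH]; first by rewrite mul0r (ent_nil hE).
  have [_ /ltW] := pickP (past k); rewrite -/(s k) -sE /cond_ent.
  rewrite mkseqS (@ent_eq (rcons _ _) ([:: s k] ++ mkseq s k)).
    by rewrite -addn1 natrD mulrDl mul1r; lra.
  by move=> x; rewrite mem_rcons.
Qed.

End EntropyLike.

(** * Strips of the lattice *)

(** Pigeonhole: slice the wide strip along its direction into finitely many
    pieces of width [b / 2].  Two points of one piece differ by an element of
    the strip of width [b], so one representative of each nonempty piece
    suffices. *)
Lemma strip_widen {R : realType} (beta b b' : R) : 0 < b ->
  exists F : seq (int * int),
    strip beta b' `<=` [set w1 + w2 | w1 in strip beta b & w2 in [set` F]].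
Proof.
move=> b0.
pose height (w : int * int) : R := w.2%:~R - beta * w.1%:~R.
pose cell w := Num.truncn ((height w + b' / 2) / (b / 2)).
have cellP w : strip beta b' w ->
    (cell w)%:R * (b / 2) <= height w + b' / 2 < (cell w).+1%:R * (b / 2).
  move=> /andP[lo hi].
  rewrite -ler_pdivlMr ?divr_gt0// -ltr_pdivrMr ?divr_gt0//.
  have b2 : 0 <= b / 2 by rewrite divr_ge0 ?ltW.
  by apply: truncn_itv; rewrite divr_ge0// /height; lra.
have /choice[rep repP] (k : nat) : exists g : int * int,
    forall w, strip beta b' w -> cell w = k -> strip beta b' g /\ cell g = k.
  (* A piece without lattice points gets the irrelevant representative 0. *)
  have [[g [Lg gk]]|no] := pselect (exists g, strip beta b' g /\ cell g = k).
    by exists g.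
  by exists 0 => w Lw wk; exfalso; apply: no; exists w.
pose N := Num.truncn (b' / (b / 2)).
exists [seq rep k | k <- iota 0 N.+1] => w Lw.
exists (w - rep (cell w)); last first.
  exists (rep (cell w)); last by rewrite subrK.
  apply/mapP; exists (cell w) => //; rewrite mem_iota add0n ltnS /=.
  apply: le_truncn; rewrite ler_pM2r ?invr_gt0 ?divr_gt0//.
  by move: Lw => /andP[]; rewrite /height; lra.
have [Lg cg] := repP _ w Lw erefl.
have /andP[] := cellP _ Lg; have /andP[] := cellP _ Lw.
rewrite cg -[(cell w).+1%:R]natr1 /height /strip /= !intrB mulrBr.
move: (cell w)%:R => c *; apply/andP; split; lra.
Qed.

(** Starting at [w], move back along the first direction until its height
    above the second line is bounded.  A step in the abscissa along the first
    direction changes that height by [beta1 - beta2], which is nonzero.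
    Rounding to lattice points costs at most 1 in the height above the first
    line and |beta1 - beta2| + 1 in the height above the second, whence the
    two widths. *)
Lemma plane_two_strips {R : realType} (beta1 beta2 : R) : beta1 != beta2 ->
  [set: int * int] `<=`
  [set w1 + w2 | w1 in strip beta1 2 &
                 w2 in strip beta2 (2 * (`|beta1 - beta2| + 1))].
Proof.
rewrite -subr_eq0 => d0 w _; set d := beta1 - beta2 in d0 *.
pose m1 := Num.floor ((w.2%:~R - beta2 * w.1%:~R) / d).
pose n1 := Num.floor (beta1 * m1%:~R).
have /andP[n1l n1u] := floor_itv (beta1 * m1%:~R).
have /andP[m1l m1u] := floor_itv ((w.2%:~R - beta2 * w.1%:~R) / d).
rewrite -/n1 intrD in n1l n1u; rewrite -/m1 intrD in m1l m1u.
have : `|(w.2%:~R - beta2 * w.1%:~R) - m1%:~R * d| <= `|d|.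
  have -> : (w.2%:~R - beta2 * w.1%:~R) - m1%:~R * d =
     ((w.2%:~R - beta2 * w.1%:~R) / d - m1%:~R) * d.
    by rewrite mulrBl divfK.
  by rewrite normrM ler_piMl// ger0_norm; lra.
rewrite ler_norml => /andP[dl du].
exists (m1, n1); first by rewrite /strip /=; lra.
exists (w - (m1, n1)); last by rewrite addrC subrK.
rewrite /strip /= !intrB.
rewrite {2 3}/d in dl du; apply/andP; split; lra.
Qed.

(** * Upper limits of real sequences *)

Lemma limn_esup_gt0 {R : realType} (u : nat -> R) (e : R) : 0 < e ->
  (forall k, e <= u k) -> (0 < limn_esup (fun k => (u k)%:E))%E.
Proof.
move=> e0 eu; apply: (@lt_le_trans _ _ e%:E); first by rewrite lte_fin.
apply: le_ereal_inf_tmp => _ [V VF <-].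
have [k Vk] : V !=set0 by exact: (@filter_ex _ \oo).
apply: (@le_trans _ _ (u k)%:E); first by rewrite lee_fin.
by apply: ereal_sup_ubound; exists k.
Qed.

Lemma limn_esup_le0 {R : realType} (u : nat -> R) :
  (forall e, 0 < e -> exists C, 0 <= C /\ forall k, u k <= C / k.+1%:R + e) ->
  (limn_esup (fun k => (u k)%:E) <= 0)%E.
Proof.
move=> H; apply/lee_addgt0Pr => e e0; rewrite add0e.
have [C [C0 uC]] := H _ (divr_gt0 e0 (ltr0Sn _ 1)).
pose N := Num.truncn (C / (e / 2)).
apply: (@le_trans _ _ (ereal_sup
    [set (u k)%:E | k in [set k | (N <= k)%N]])).
  apply: ereal_inf_lbound; exists [set k | (N <= k)%N] => //.
  by exists N.
apply: ge_ereal_sup => _ [k /= Nk <-]; rewrite lee_fin.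
apply: (le_trans (uC k)); rewrite [leRHS](splitr e) lerD2r.
rewrite ler_pdivrMr ?ltr0n// mulrC -ler_pdivrMr ?divr_gt0//.
have := truncnS_gt (C / (e / 2)); rewrite -/N => /ltW/le_trans; apply.
by rewrite ler_nat.
Qed.

(** * Entropy inequalities on finite alphabets *)

Definition eta {R : realType} (x : R) : R := - (x * ln x).

Lemma eta_sum_le {R : realType} (U : finType) (p : U -> R) :
  (forall u, 0 <= p u) -> eta (\sum_u p u) <= \sum_u eta (p u).
Proof.
move=> p0; rewrite /eta sumrN lerN2 mulr_suml; apply: ler_sum => u _.
have := p0 u; rewrite le_eqVlt => /orP[/eqP <-|pu]; first by rewrite !mul0r.
have put : p u <= \sum_u p u by rewrite (bigD1 u)//= lerDl sumr_ge0.
by rewrite ler_pM2l// ler_ln// posrE// (lt_le_trans pu).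
Qed.

(** The nonnegativity of mutual information, for a finite measure of any total
    mass [t]: with row sums r and column sums c, the inequality
    [ln x <= x - 1] at x = r c / (p t) bounds the difference of the two sides
    by the sum of r c / t - p, which vanishes.  Since no normalization is
    assumed, the inequality can be applied inside each cell of a conditioning
    partition, which gives the submodularity of entropy. *)
Lemma eta_submod {R : realType} (U V : finType) (p : U -> V -> R) :
  (forall u v, 0 <= p u v) ->
  \sum_u \sum_v eta (p u v) + eta (\sum_u \sum_v p u v) <=
  \sum_u eta (\sum_v p u v) + \sum_v eta (\sum_u p u v).
Proof.
move=> p0; pose r u := \sum_v p u v; pose c v := \sum_u p u v.
pose t := \sum_u r u.
have r0 u : 0 <= r u by exact: sumr_ge0.
have c0 v : 0 <= c v by exact: sumr_ge0.
have tE : t = \sum_v c v by rewrite /t /r exchange_big.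
have t0 : 0 <= t by exact: sumr_ge0.
have rp u v : p u v <= r u by rewrite /r (bigD1 v)//= lerDl sumr_ge0.
have cp u v : p u v <= c v by rewrite /c (bigD1 u)//= lerDl sumr_ge0.
have tr u : r u <= t by rewrite /t (bigD1 u)//= lerDl sumr_ge0.
suff H : \sum_u \sum_v p u v * (ln (r u) + ln (c v) - ln (p u v) - ln t) <= 0.
  rewrite -subr_le0; apply: le_trans H; rewrite le_eqVlt; apply/orP; left.
  apply/eqP; transitivity (\sum_u \sum_v (p u v * ln (r u) + p u v * ln (c v)
      - p u v * ln (p u v) - p u v * ln t)); last first.
    by apply: eq_bigr => u _; apply: eq_bigr => v _; rewrite !mulrDr !mulrN.
  under [RHS]eq_bigr do rewrite sumrB sumrB big_split/=.
  rewrite sumrB sumrB big_split/=.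
  have -> : \sum_u \sum_v p u v * ln (r u) = \sum_u r u * ln (r u).
    by apply: eq_bigr => u _; rewrite -mulr_suml.
  have -> : \sum_u \sum_v p u v * ln (c v) = \sum_v c v * ln (c v).
    by rewrite exchange_big; apply: eq_bigr => v _; rewrite -mulr_suml.
  have -> : \sum_u \sum_v p u v * ln t = t * ln t.
    by rewrite mulr_suml; apply: eq_bigr => u _; rewrite -mulr_suml.
  under eq_bigr do rewrite sumrN.
  by rewrite /eta !sumrN -/t -/r -/c; lra.
have [t_gt0|t_le0] := ltP 0 t; last first.
  rewrite big1// => u _; rewrite big1// => v _.
  suff -> : p u v = 0 by rewrite mul0r.
  by apply/eqP; rewrite eq_le p0 andbT (le_trans (rp u v))// (le_trans (tr u)).
apply: (@le_trans _ _ (\sum_u \sum_v (r u * c v / t - p u v))); last first.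
  under eq_bigr do rewrite sumrB.
  rewrite sumrB -/r -/t; under eq_bigr do rewrite -mulr_suml -mulr_sumr -tE.
  by rewrite -!mulr_suml mulfK ?gt_eqF// subrr.
apply: ler_sum => u _; apply: ler_sum => v _.
have := p0 u v; rewrite le_eqVlt => /orP[/eqP <-|pu].
  by rewrite mul0r subr0 divr_ge0 ?mulr_ge0.
have ru : 0 < r u by rewrite (lt_le_trans pu).
have cv : 0 < c v by rewrite (lt_le_trans pu).
have -> : r u * c v / t - p u v = p u v * (r u * c v / (p u v * t) - 1).
  by rewrite mulrBr mulr1 invfM [in RHS]mulrCA mulVKf ?gt_eqF.
rewrite ler_pM2l//.
have -> : ln (r u) + ln (c v) - ln (p u v) - ln t =
    ln (r u * c v / (p u v * t)).
  by rewrite ln_div ?posrE ?mulr_gt0// !lnM ?posrE//; lra.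
rewrite -[X in ln X](subrKC 1); apply: le_ln1Dx.
by rewrite ltrDr divr_gt0 ?mulr_gt0.
Qed.

(** Partitions are handled as fibers of maps: the join of two partitions is
    the partition into fibers of the pair of maps. *)
Definition fibers {S J : Type} (f : S -> J) : set (set S) :=
  [set f @^-1` [set f x] | x in setT].

(** This turns identities between joins into equivalences of systems of
    equations, whatever the types of the values are. *)
Lemma eq_fibers {S J K : Type} (f : S -> J) (g : S -> K) :
  (forall x y, f x = f y <-> g x = g y) -> fibers f = fibers g.
Proof.
move=> fg; rewrite /fibers.
suff -> : (fun x => f @^-1` [set f x]) = (fun x => g @^-1` [set g x]) by [].
by apply/funext => x; apply/seteqP; split=> y /= /fg.
Qed.

Lemma sum_fsbigT (R : nmodType) (J : finType) (F : J -> R) :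
  \sum_j F j = \sum_(j \in [set: J]) F j.
Proof.
rewrite fsbig_seq ?index_enum_uniq//; apply: eq_fsbigl.
by apply/seteqP; split=> j //= _; rewrite mem_index_enum.
Qed.

Section EntropyFibers.
Variables (R : realType) (X : pmetricType R) (mu : probability (borel X) R).
Local Notation P A := (fine (mu A)).

(** Values that are not attained do not correspond to cells; they contribute
    [0 * ln 0 = 0]. *)
Lemma entropy_fibers (J : finType) (f : borel X -> J) :
  entropy mu (fibers f) = \sum_j eta (P (f @^-1` [set j])).
Proof.
rewrite /entropy /eta sumrN; congr (- _).
have -> : fibers f = (fun j => f @^-1` [set j]) @` range f.
  by rewrite /fibers image_comp.
rewrite fsbig_image; last first.
  move=> _ k /set_mem[x _ <-] _ fxk.
  by have : (f @^-1` [set f x]) x by []; rewrite fxk.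
rewrite sum_fsbigT.
apply: fsbig_widen => // j [_ /= nj].
rewrite (_ : f @^-1` [set j] = set0) ?measure0 ?mul0r//.
by apply/seteqP; split=> // x /= fx; apply: nj; exists x.
Qed.

Lemma measure_split (J : finType) (f : borel X -> J) (A : set (borel X)) :
  (forall j, measurable (f @^-1` [set j])) -> measurable A ->
  P A = \sum_j P (f @^-1` [set j] `&` A).
Proof.
move=> mf mA.
have finP B : measurable B -> (mu B \is a fin_num) by exact: fin_num_measure.
rewrite sum_fine; last by move=> j _; apply: finP; exact: measurableI.
congr fine; rewrite sum_fsbigT -measure_fin_bigcup; last 3 first.
- exact: finite_finset.
- by move=> i j _ _ [x [[/= <- _] [<- _]]].
- by move=> j _; exact: measurableI.
- congr (mu _); apply/seteqP; split=> [x Ax|x [j _ [] //]].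
  by exists (f x).
Qed.


Lemma entropy_fibers_pair (J K : finType) (f : borel X -> J)
    (g : borel X -> K) :
  entropy mu (fibers (fun x => (f x, g x))) =
  \sum_k \sum_j eta (P (f @^-1` [set j] `&` g @^-1` [set k])).
Proof.
rewrite entropy_fibers exchange_big pair_bigA; apply: eq_bigr => -[j k] _ /=.
by congr (eta (P _)); apply/seteqP; split=> x /= [-> ->].
Qed.

Lemma entropy_fibers_le_pair (J K : finType) (f : borel X -> J)
    (g : borel X -> K) :
  (forall j, measurable (f @^-1` [set j])) ->
  (forall k, measurable (g @^-1` [set k])) ->
  entropy mu (fibers g) <= entropy mu (fibers (fun x => (f x, g x))).
Proof.
move=> mf mg; rewrite entropy_fibers_pair entropy_fibers; apply: ler_sum => k _.
by rewrite (measure_split mf)//; apply: eta_sum_le => j; exact: fine_ge0.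
Qed.

Lemma entropy_fibers_submod (J K L : finType) (f : borel X -> J)
    (g : borel X -> K) (h : borel X -> L) :
  (forall j, measurable (f @^-1` [set j])) ->
  (forall k, measurable (g @^-1` [set k])) ->
  (forall l, measurable (h @^-1` [set l])) ->
  entropy mu (fibers (fun x => (f x, (g x, h x)))) + entropy mu (fibers h) <=
  entropy mu (fibers (fun x => (f x, h x))) +
  entropy mu (fibers (fun x => (g x, h x))).
Proof.
move=> mf mg mh.
rewrite (_ : fibers _ = fibers (fun x => ((f x, g x), h x))); last first.
  by apply: eq_fibers => x y; split=> [[-> -> ->]|[-> -> ->]].
rewrite !entropy_fibers_pair entropy_fibers -!big_split.
apply: ler_sum => l _ /=.
pose p j k := P (f @^-1` [set j] `&` (g @^-1` [set k] `&` h @^-1` [set l])).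
have mgh k : measurable (g @^-1` [set k] `&` h @^-1` [set l]).
  exact: measurableI.
have pg k : P (g @^-1` [set k] `&` h @^-1` [set l]) = \sum_j p j k.
  exact: measure_split.
have pf j : P (f @^-1` [set j] `&` h @^-1` [set l]) = \sum_k p j k.
  rewrite (measure_split mg); last exact: measurableI.
  by apply: eq_bigr => k _; rewrite /p setICA.
have ph : P (h @^-1` [set l]) = \sum_j \sum_k p j k.
  by rewrite (measure_split mf)//; apply: eq_bigr => j _.
have pfg : \sum_jk
    eta (P ((fun x => (f x, g x)) @^-1` [set jk] `&` h @^-1` [set l])) =
    \sum_j \sum_k eta (p j k).
  rewrite pair_bigA; apply: eq_bigr => -[j k] _ /=; congr (eta (P _)).
  by rewrite setIA; congr (_ `&` _); apply/seteqP; split=> x /= [-> ->].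
rewrite pfg ph; under [X in _ <= X + _]eq_bigr do rewrite pf.
under [X in _ <= _ + X]eq_bigr do rewrite pg.
by apply: eta_submod => j k; exact: fine_ge0.
Qed.

End EntropyFibers.

(** * Entropy of the joins of the translates of a partition *)

Section JoinEntropy.
Variables (R : realType) (X : pmetricType R) (mu : probability (borel X) R).
Variables (T : int * int -> X -> X) (I : finType) (label : borel X -> I).
Hypothesis TE : is_Z2MPS mu T.
Hypothesis mlabel : forall i, measurable (label @^-1` [set i]).

Definition name (F : seq (int * int)) (x : borel X) : seq I :=
  [seq label (T w x) | w <- F].

Definition join_ent (F : seq (int * int)) : R := entropy mu (fibers (name F)).

(** The same name with values in a finite type, which depends on the length
    of [F]; names in [seq I] can be compared for different [F]. *)
Let tname F (x : borel X) : (size F).-tuple I :=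
  map_tuple (fun w => label (T w x)) (in_tuple F).

Lemma measurable_shift w (A : set (borel X)) :
  measurable A -> measurable (T w @^-1` A : set (borel X)).
Proof.
move=> mA; rewrite -[X in measurable X]setTI.
have [+ _] := Z2MPS_homeo TE w => /continuousP Tc.
apply: (@measurability _ _ (borel X) (borel X) setT (T w) (@open X)) => //.
by move=> _ [U oU <-]; rewrite setTI; apply: sub_sigma_algebra; exact: Tc.
Qed.

Lemma measurable_tname F (t : (size F).-tuple I) :
  measurable (tname F @^-1` [set t]).
Proof.
rewrite (_ : tname F @^-1` [set t] = [set x | name F x = val t]); last first.
  by apply/seteqP; split=> x /= => [<-|?]; last exact: val_inj.
move: (val t) => {t}; elim: F => [|w F IH] [|a s].
- by rewrite (_ : mkset _ = setT)//; apply/seteqP; split.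
- by rewrite (_ : mkset _ = set0)//; apply/seteqP; split.
- by rewrite (_ : mkset _ = set0)//; apply/seteqP; split.
- rewrite (_ : mkset _ =
    T w @^-1` (label @^-1` [set a]) `&` [set x | name F x = s]).
    by apply: measurableI => //; exact: measurable_shift.
  by apply/seteqP; split=> x /= [-> ->].
Qed.

Lemma nameP F x y :
  name F x = name F y <-> {in F, forall w, label (T w x) = label (T w y)}.
Proof. by split=> [/eq_in_map|/eq_in_map]. Qed.

Lemma join_entE F : join_ent F = entropy mu (fibers (tname F)).
Proof.
by congr entropy; apply: eq_fibers => x y; split=> [?|[]//]; exact: val_inj.
Qed.

Lemma join_ent_entropy_like : entropy_like join_ent.
Proof.
split.
- rewrite /join_ent (_ : fibers _ = [set setT]); last first.
    apply/seteqP; split=> [_ [x _ <-]|_ ->]; first by apply/seteqP.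
    by exists point => //; apply/seteqP.
  by rewrite /entropy fsbig_set1 probability_setT /= ln1 mulr0 oppr0.
- move=> A B AB; rewrite !join_entE.
  rewrite (_ : fibers (tname B) = fibers (fun x => (tname B x, tname A x))).
    by apply: entropy_fibers_le_pair => ?; exact: measurable_tname.
  apply: eq_fibers => x y; split=> /= [xy|/(congr1 fst)//].
  suff -> : tname A x = tname A y by rewrite xy.
  apply: val_inj; apply/nameP => w /AB wB.
  by have /nameP := congr1 val xy; exact.
- move=> A B C; rewrite (join_entE C).
  have pE F F' : join_ent (F ++ F') =
      entropy mu (fibers (fun x => (tname F x, tname F' x))).
    congr entropy; apply: eq_fibers => x y; split=> /= [/nameP xy|].
      suff [-> ->] : tname F x = tname F y /\ tname F' x = tname F' y by [].
      by split; apply: val_inj; apply/nameP => w wF; apply: xy;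
        rewrite mem_cat wF ?orbT.
    move=> [/nameP xy /nameP xy']; apply/nameP => w.
    by rewrite mem_cat => /orP[/xy|/xy'].
  rewrite !pE (_ : fibers (fun x => (tname A x, _)) =
      fibers (fun x => (tname A x, (tname B x, tname C x)))).
    by apply: entropy_fibers_submod => ?; exact: measurable_tname.
  apply: eq_fibers => x y; split=> /=.
    move=> [/nameP xA /nameP xBC].
    suff [-> -> ->] : [/\ tname A x = tname A y, tname B x = tname B y
      & tname C x = tname C y] by [].
    by split; apply: val_inj; apply/nameP => // w wF; apply: xBC;
      rewrite mem_cat wF ?orbT.
  move=> [/nameP xA /nameP xB /nameP xC].
  suff [-> ->] : tname A x = tname A y /\
    tname (B ++ C) x = tname (B ++ C) y by [].
  split; apply: val_inj; apply/nameP => // w.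
  by rewrite mem_cat => /orP[/xB|/xC].
- move=> w A.
  have nE x : name [seq w + a | a <- A] x = name A (T w x).
    rewrite /name -map_comp; apply: eq_map => a /=.
    by rewrite addrC -(Z2MPS_add TE).
  rewrite (join_entE A) /join_ent.
  rewrite (_ : fibers (name _) = fibers (tname A \o T w)); last first.
    apply: eq_fibers => x y; rewrite !nE.
    by split=> [xy|/(congr1 val)//]; exact: val_inj.
  rewrite !entropy_fibers; apply: eq_bigr => t _.
  by rewrite comp_preimage (Z2MPS_invariant TE)//; exact: measurable_tname.
Qed.

End JoinEntropy.


(** The label of a point is the index of its cell in an enumeration of the
    partition, the bound of the index being enlarged by one to keep the
    ordinal type inhabited. *)
Lemma partition_fibers (R : realType) (X : pmetricType R)
    (alpha : set (set (borel X))) :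
  finite_measurable_partition alpha ->
  exists (n : nat) (label : borel X -> 'I_n),
    alpha = fibers label /\ forall i, measurable (label @^-1` [set i]).
Proof.
move=> [/finite_seqP[s sE] [cov triv ne] meas].
have /choice[cell cellP] (x : borel X) : exists A, alpha A /\ A x.
  have : cover alpha id x by rewrite cov.
  by move=> [A aA Ax]; exists A.
have cellE A x : alpha A -> A x -> cell x = A.
  move=> aA Ax; have [ac cx] := cellP x.
  by apply: (triv _ _ ac aA); exists x.
have fib x : [set y | cell y = cell x] = cell x.
  apply/seteqP; split=> y /= => [<-|cy]; first by have [] := cellP y.
  by apply: cellE => //; have [] := cellP x.
pose label x : 'I_(size s).+1 := inord (index (cell x) s).
have labelP x y : label x = label y <-> cell x = cell y.
  split=> [|xy]; last by rewrite /label xy.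
  have ms z : cell z \in s.
    by have [+ _] := cellP z; rewrite sE.
  move=> /(congr1 val); rewrite /= !inordK ?ltnS ?index_size//.
  exact: (index_inj set0 (ms x) (ms y)).
exists (size s).+1, label; split.
  rewrite (eq_fibers labelP) /fibers.
  apply/seteqP; split=> [A aA|_ [x _ <-]].
    have [x Ax] := ne _ aA; exists x => //.
    by rewrite -(cellE _ _ aA Ax); exact: fib.
  rewrite (_ : _ @^-1` _ = cell x); last exact: fib.
  by have [] := cellP x.
move=> i; have [[x lx]|no] := pselect (exists x, label x = i).
  rewrite -lx (_ : _ @^-1` _ = cell x); last first.
    by rewrite -fib; apply/seteqP; split=> y /= /labelP.
  by apply: meas; have [] := cellP x.
rewrite (_ : _ @^-1` _ = set0)//; apply/seteqP; split=> // x /= lx.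
by apply: no; exists x.
Qed.

Section JoinPartition.
Variables (R : realType) (X : pmetricType R) (mu : probability (borel X) R).
Variables (T : int * int -> X -> X) (I : finType) (label : borel X -> I).
Hypothesis TE : is_Z2MPS mu T.

Lemma pullback_fibers w :
  pullback_partition T w (fibers label) = fibers (label \o T w).
Proof.
have TK u : cancel (T u) (T (- u)).
  move=> x; have /(congr1 (@^~ x)) /= -> := Z2MPS_add TE (- u) u.
  by rewrite addNr (Z2MPS_id TE).
have TVK u : cancel (T (- u)) (T u) by have := TK (- u); rewrite opprK.
have im x : T (- w) @` (label @^-1` [set label x]) =
    (label \o T w) @^-1` [set label x].
  apply/seteqP; split=> [_ [y /= yx <-]|y /= yx]; first by rewrite TVK.
  by exists (T w y) => //; exact: TK.
apply/seteqP; split=> [_ [_ [x _ <-] <-]|_ [x _ <-]].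
  by exists (T (- w) x) => //=; rewrite im TVK.
by exists (label @^-1` [set label (T w x)]); [exists (T w x)|rewrite im].
Qed.

Lemma join_pullback_fibers (s : nat -> int * int) k :
  join_partition (fun i => pullback_partition T (s i) (fibers label)) k =
  fibers (name T label (mkseq s k)).
Proof.
have nE x : name T label (mkseq s k) @^-1` [set name T label (mkseq s k) x] =
    \bigcap_(i in `I_k) ((label \o T (s i)) @^-1` [set label (T (s i) x)]).
  apply/seteqP; split=> y /=.
    move=> /nameP yx i /= ik; apply: yx.
    by apply/mapP; exists i; rewrite ?mem_iota.
  move=> yx; apply/nameP => w /mapP[i]; rewrite mem_iota => ik ->.
  exact: (yx i).
apply/seteqP; split=> [B [[x Bx] [C CP BE]]|_ [x _ <-]]; last first.
  split; first by exists x.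
  exists (fun i => (label \o T (s i)) @^-1` [set label (T (s i) x)]) => //.
  by move=> i _; rewrite pullback_fibers; exists x.
exists x => //; rewrite nE BE; apply: eq_bigcapr => i /= ik.
have := CP i ik; rewrite pullback_fibers => -[z _ Cz].
have : C i x by rewrite BE in Bx; exact: Bx.
by rewrite -Cz /= => ->.
Qed.

Lemma seq_entropy_join_ent (s : nat -> int * int) :
  seq_entropy mu T (fibers label) s =
  limn_esup (fun k => (k.+1%:R^-1 * join_ent mu T label (mkseq s k.+1))%:E).
Proof. by congr limn_esup; apply/funext => k; rewrite join_pullback_fibers. Qed.

Hypothesis mlabel : forall i, measurable (label @^-1` [set i]).

(** The prefactor 1 / k turns a bound C + k e for the joint entropy into
    C / k + e. *)
Lemma seq_entropy_le0 (s : nat -> int * int) :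
  ent_precompact (join_ent mu T label) setT ->
  (seq_entropy mu T (fibers label) s <= 0)%E.
Proof.
move=> c; rewrite seq_entropy_join_ent; apply: limn_esup_le0 => e e0.
have [C [C0 CP]] :=
  precompact_sublinear (join_ent_entropy_like TE mlabel) s c e0.
exists C; split=> // k; rewrite ler_pdivrMl ?ltr0n// mulrDr.
by rewrite [_ * (C / _)]mulrC divfK ?pnatr_eq0.
Qed.

Lemma precompact_strip (b beta : R) :
  dir_seq_entropy mu T (fibers label) b beta = 0%E ->
  ent_precompact (join_ent mu T label) (strip beta b).
Proof.
move=> d0; apply: contrapT.
move=> /(not_precompact_linear (join_ent_entropy_like TE mlabel)).
move=> [e [e0 [s [sI sL se]]]].
have : (seq_entropy mu T (fibers label) s <= 0)%E.
  by rewrite -d0; apply: ereal_sup_ubound; exists s.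
apply/negP; rewrite -ltNge seq_entropy_join_ent.
by apply: (limn_esup_gt0 e0) => k; rewrite ler_pdivlMl ?ltr0n.
Qed.

End JoinPartition.

Theorem theorem1p5 (R : realType) (X : pmetricType R)
    (mu : probability (borel X) R) (T : int * int -> X -> X)
    (alpha : set (set (borel X))) (b : R) :
  is_Z2MPS mu T ->
  finite_measurable_partition alpha ->
  0 < b ->
  (exists s : nat -> int * int,
     injective s /\ (0 < seq_entropy mu T alpha s)%E) ->
  is_subset1 [set beta : R | dir_seq_entropy mu T alpha b beta = 0%E].
Proof.
move=> TE /partition_fibers[n [label [-> mlabel]]] b0 [s [_ hs]].
(* Two different directions of vanishing entropy would make Z^2 precompact. *)
move=> beta1 beta2 /= d1 d2; apply/eqP/negPn/negP => neq.
have hE := join_ent_entropy_like TE mlabel.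
have wide beta b' : dir_seq_entropy mu T (fibers label) b beta = 0%E ->
    ent_precompact (join_ent mu T label) (strip beta b').
  move=> /(precompact_strip TE mlabel) c; have [F FP] := strip_widen beta b' b0.
  by apply: precompact_subset FP _; apply: precompact_add => //;
    exact: precompact_seq.
suff /(seq_entropy_le0 TE mlabel s) : ent_precompact (join_ent mu T label) setT.
  by apply/negP; rewrite -ltNge.
apply: precompact_subset (plane_two_strips neq) _.
by apply: precompact_add => //; exact: wide.
Qed.
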